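(* Let $S=(S_p,I_F)$ and $S'=(S_p,I_F')$ be canonical Local Friendliness scenarios with the same public scenario $S_p=(I_A,M,O)$ and with $\emptyset\neq I_F'\subsetneq I_F$. Then either $\mathcal{LF}(S)=\mathcal{LF}(S')=\mathcal{B}(S_p)$ or $\mathcal{LF}(S)\subsetneq\mathcal{LF}(S')$.
   Context: Canonical (standard) Local Friendliness (LF) scenario: a quadruple $S=(I_A,I_F,M,O)$, also written $S=(S_p,I_F)$ with $S_p=(I_A,M,O)$ the public scenario, where $I_A=\{1,\dots,N\}$ is a finite set of parties (superobservers), $I_F\subset I_A$ (possibly empty, possibly all of $I_A$) is the set of parties having a ''friend'', $M=M_1\times\dots\times M_N$ with $M_i=\{1,\dots,m_i\}$ the finite set of measurement settings of party $i$, and for each $i$ and $x_i\in M_i$ there is a finite outcome set $O_{x_i}$ (depending on $i$ and on the setting $x_i$); for $\vec x\in M$ put $O_{\vec x}=O_{x_1}\times\dots\times O_{x_N}$, and $O=\{O_{\vec x}\}_{\vec x\in M}$. The sets $I_A$, $M_i$, $O_{x_i}$ all have cardinality at least 2. The symbol $\subset$ denotes non-strict inclusion and $\subsetneq$ strict inclusion. For $J\subset I_A$, $\vec a_J$ and $\vec x_J$ denote the substrings indexed by $J$. Behaviour: a family $\wp=(\wp(\cdot|\vec x))_{\vec x\in M}$ where $\wp(\cdot|\vec x)$ is a probability distribution on $O_{\vec x}$. $\mathcal{B}(S)=\mathcal{B}(S_p)$: the set of behaviours admitting a local hidden variable (LHV) model, i.e. $\wp(\vec a|\vec x)=\int_\Lambda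 d\lambda\,p(\lambda)\prod_{i=1}^N P(a_i|x_i,\lambda)$ for all $\vec a,\vec x$, for some probability space $(\Lambda,p)$ and, for each $i$, $x_i$, $\lambda$, a probability distribution $P(\cdot|x_i,\lambda)$ on $O_{x_i}$. It does not depend on $I_F$. $\mathcal{LF}(S)$: the set of behaviours $\wp$ for which there exist a probability distribution $P(\vec c)$ on strings $\vec c=(c_i)_{i\in I_F}\in\prod_{i\in I_F}O_{x_i=1}$ (here $O_{x_i=1}$ is the outcome set of party $i$'s setting $1$) and, for each $\vec c$ and $\vec x\in M$, a probability distribution $P(\cdot|\vec x,\vec c)$ on $O_{\vec x}$, such that: (1) $\wp(\vec a|\vec x)=\sum_{\vec c}P(\vec a|\vec x,\vec c)P(\vec c)$; (2) (Local Agency) for every $V\subset I_A$ the marginal $P(\vec a_V|\vec x,\vec c)$ depends on $\vec x$ only through $\vec x_V$; (3) with $F_{\vec x}=\{i\in I_F: x_i=1\}$, $P(\vec a_{F_{\vec x}}|\vec x,\vec c)=\prod_{i\in F_{\vec x}}\delta_{a_i,c_i}$. Equivalently $\wp(\vec a|\vec x)=\sum_{\vec c}\prod_{i\in F_{\vec x}}\delta_{a_i,c_i}\,P(\vec a_{J_{\vec x}}|\vec x_{J_{\vec x}},\vec c)\,P(\vec c)$ with $J_{\vec x}=I_A\setminus F_{\vec x}$, the $P(\cdot|\cdot,\vec c)$ satisfying Local Agency. If $I_F=\emptyset$, $\vec c$ is the empty string. *)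

(* Defs.v *)
From mathcomp Require Import all_boot all_order all_algebra.
From mathcomp Require Import all_classical all_reals all_analysis.

Set Implicit Arguments.
Unset Strict Implicit.
Unset Printing Implicit Defensive.

Import Order.TTheory GRing.Theory Num.Theory.
Local Open Scope classical_set_scope.
Local Open Scope ring_scope.

Record public_scenario := PublicScenario {
  nparties : nat;
  nsettings : 'I_nparties -> nat;
  outcome : forall i : 'I_nparties, 'I_(nsettings i) -> finType;
  nparties_gt1 : (1 < nparties)%N;
  nsettings_gt1 : forall i, (1 < nsettings i)%N;
  outcome_gt1 : forall i (s : 'I_(nsettings i)), (1 < #|outcome s|)%N }.

Definition party (S : public_scenario) := 'I_(nparties S).

Definition setting (S : public_scenario) (i : party S) := 'I_(nsettings i).

(* Settings are numbered from 0, so this is the setting written [x_i = 1]. *)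
Definition setting1 (S : public_scenario) (i : party S) : setting i :=
  Ordinal (ltnW (nsettings_gt1 i)).

Definition settings (S : public_scenario) := {dffun forall i : party S, setting i}.

Definition outcomes (S : public_scenario) (x : settings S) :=
  {dffun forall i : party S, outcome (x i)}.

Definition is_distribution (R : realType) (T : finType) (p : T -> R) : Prop :=
  (forall t, 0 <= p t) /\ \sum_t p t = 1.

Definition cond_family (R : realType) (S : public_scenario) :=
  forall x : settings S, outcomes x -> R.

Definition is_behaviour (R : realType) (S : public_scenario)
    (w : cond_family R S) : Prop :=
  forall x, is_distribution (w x).

Definition LHV (R : realType) (S : public_scenario) : set (cond_family R S) :=
  [set w | is_behaviour w /\
    exists (d : measure_display) (L : measurableType d) (p : probability L R)
           (P : forall (i : party S) (s : setting i), L -> outcome s -> R),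
      [/\ forall i (s : setting i) (a : outcome s),
            measurable_fun [set: L] (fun l => P i s l a),
          forall i (s : setting i) l, is_distribution (P i s l)
        & forall x (a : outcomes x),
            (w x a)%:E = (\int[p]_l (\prod_i P i (x i) l (a i))%:E)%E]].

(* An outcome paired with its setting: this allows outcomes of the same party
   to be compared when their settings are only propositionally equal. *)
Definition tag_outcome (S : public_scenario) (i : party S) (s : setting i)
    (a : outcome s) : {s : setting i & outcome s} :=
  Tagged (fun s : setting i => outcome s) a.

(* The marginal probability of the substring [a_V], for the settings [x]. *)
Definition marginal (R : realType) (S : public_scenario) (w : cond_family R S)
    (V : {set party S}) (x : settings S) (a : outcomes x) : R :=
  \sum_(b : outcomes x | [forall i in V, b i == a i]) w x b.

(* The hypothesis says [x_V = x'_V] and [a_V = a'_V]. Every substring [a_V]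
   extends to a full string because the outcome sets are nonempty. *)
Definition local_agency (R : realType) (S : public_scenario)
    (w : cond_family R S) : Prop :=
  forall (V : {set party S}) (x x' : settings S)
         (a : outcomes x) (a' : outcomes x'),
    (forall i, i \in V -> tag_outcome (a i) = tag_outcome (a' i)) ->
    marginal w V a = marginal w V a'.

Definition friend_outcomes (S : public_scenario) (IF : {set party S}) :=
  {dffun forall j : {i : party S | i \in IF}, outcome (setting1 (val j))}.

Definition measured_friends (S : public_scenario) (IF : {set party S})
    (x : settings S) : {set party S} :=
  [set i in IF | x i == setting1 i].

Definition LF (R : realType) (S : public_scenario) (IF : {set party S}) :
    set (cond_family R S) :=
  [set w | is_behaviour w /\
    exists (Pc : friend_outcomes IF -> R) (P : friend_outcomes IF -> cond_family R S),
      [/\ is_distribution Pc,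
          forall c, is_behaviour (P c),
          forall x (a : outcomes x), w x a = \sum_c P c x a * Pc c,
          forall c, local_agency (P c)
        & forall c x (a : outcomes x),
            marginal (P c) (measured_friends IF x) a =
            \prod_(j : {i : party S | i \in IF}
                     | val j \in measured_friends IF x)
              (tag_outcome (a (val j)) == tag_outcome (c j))%:R]].

Arguments LHV R S : clear implicits.
Arguments LF R {S} IF.

(* Main.v *)
(* LF is antitone in the set of friends and always contains LHV. Fix k in IF but
   not in IF'.

   If some other party j has two settings none of which is the first setting of
   a party with a friend in IF', then a Popescu-Rohrlich box shared by k (with
   its first two settings) and j, all other outputs being fixed, lies in LF IF'.
   It is not in LF IF: there, given c, the output of k under its first setting
   is fixed, and following the supports around the four pairs of settings, with
   no-signalling at each step, gives a contradiction.

   Otherwise every party other than k has exactly two settings and a friend in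
   IF'. Given c, its first output is fixed, so the outputs b of these parties
   under their second settings, together with c, are a hidden variable: party k
   answers according to its distribution conditional on b. Hence LF IF' = LHV. *)

Require Import Defs.
From HB Require Import structures.
From mathcomp Require Import all_boot all_order all_algebra.
From mathcomp Require Import all_classical all_reals all_analysis.
From mathcomp Require Import measurable_realfun.

Set Implicit Arguments.
Unset Strict Implicit.
Unset Printing Implicit Defensive.

Import Order.TTheory GRing.Theory Num.Theory.
Local Open Scope classical_set_scope.
Local Open Scope ring_scope.

(** * Supports, marginals and mixtures of conditional families *)

Lemma tag_outcome_inj (S : public_scenario) (i : party S) (s : setting i) :
  injective (@tag_outcome S i s).
Proof. by move=> a b /eqP; rewrite eq_Tagged => /eqP. Qed.

Section Mixtures.
Variables (R : realType) (S : public_scenario).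
Implicit Types (Q : cond_family R S) (V IF : {set party S}).

Lemma marginal_ge Q V (x : settings S) (a : outcomes x) :
  is_behaviour Q -> Q x a <= marginal Q V a.
Proof.
move=> /(_ x)[Q0 _]; rewrite /marginal (bigD1 a) /=; last first.
  by apply/forall_inP => i _.
by rewrite lerDl sumr_ge0.
Qed.

(** By agency the marginals of party [i] at [x] and [x'] coincide, and the one at [x] is positive.
    This carries an output in a support from one choice of settings to another. *)
Lemma local_agency_support Q (x x' : settings S) (a : outcomes x) (i : party S) :
  is_behaviour Q -> local_agency Q -> x i = x' i -> Q x a != 0 ->
  exists2 a' : outcomes x', Q x' a' != 0 & tag_outcome (a' i) = tag_outcome (a i).
Proof.
move=> bQ aQ xx' Qa0.
have [b bi] : exists b : outcomes x', tag_outcome (b i) = tag_outcome (a i).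
  have /card_gt0P[b _] : (0 < #|{: outcomes x'}|)%N.
    have [_] := bQ x'; apply: contra_eqT; rewrite -leqNgt leqn0 => /eqP /card0_eq e.
    by rewrite big_pred0 // eq_sym oner_eq0.
  have [ai e] : exists ai : outcome (x' i), tag_outcome ai = tag_outcome (a i).
    by rewrite -xx'; exists (a i).
  exists [ffun j => dfwith (fun j => b j) i ai j].
  by rewrite ffunE dfwithin.
have e : marginal Q [set i] a = marginal Q [set i] b.
  by apply: aQ => j /set1P ->.
have mb : 0 < marginal Q [set i] b.
  rewrite -e; apply: lt_le_trans (marginal_ge _ a bQ).
  by rewrite lt0r Qa0 (bQ x).1.
apply: contrapT => no; move: mb; rewrite /marginal big1 ?ltxx// => a' /forall_inP /(_ i).
rewrite inE eqxx => /(_ isT) /eqP a'b.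
apply/eqP; apply: contraT => Qa'; exfalso; apply: no; exists a' => //.
by rewrite a'b.
Qed.

(** The delta condition of [LF] put on supports, a form that passes to mixtures without computing
    marginals. *)
Definition deterministic_on IF (c : friend_outcomes IF) Q : Prop :=
  forall (x : settings S) (a : outcomes x) (j : {i : party S | i \in IF}),
    x (val j) = setting1 (val j) -> Q x a != 0 ->
    tag_outcome (a (val j)) = tag_outcome (c j).

(** If [a] agrees with [c] on the measured friends, all the mass of [Q x] lies in the marginal; if
    not, none does. Conversely, a string of positive probability has a positive marginal, so every
    delta factor is nonzero. *)
Lemma deterministic_onP IF (c : friend_outcomes IF) Q : is_behaviour Q ->
  deterministic_on c Q <->
  forall x (a : outcomes x), marginal Q (measured_friends IF x) a =
    \prod_(j : {i : party S | i \in IF} | val j \in measured_friends IF x)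
      (tag_outcome (a (val j)) == tag_outcome (c j))%:R.
Proof.
move=> bQ; split=> [det x a|det x a j xj Qa].
- case: (boolP [forall j : {i | i \in IF}, (val j \in measured_friends IF x) ==>
    (tag_outcome (a (val j)) == tag_outcome (c j))]) => [/forallP H|].
    rewrite big1 => [|j xj]; last by have /implyP/(_ xj)/eqP -> := H j; rewrite eqxx.
    rewrite -(bQ x).2 /marginal [RHS](bigID (fun b : outcomes x =>
      [forall i in measured_friends IF x, b i == a i])) /=.
    rewrite [X in _ = _ + X]big1 ?addr0// => b; apply: contraNeq => Qb.
    apply/forall_inP => i iF; have := iF; rewrite inE => /andP[iIF /eqP xi].
    apply/eqP/tag_outcome_inj; rewrite (det x b (Sub i iIF)) //=.
    by have /implyP/(_ iF)/eqP := H (Sub i iIF).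
  rewrite negb_forall => /existsP[j]; rewrite negb_imply => /andP[jF /negbTE aj].
  rewrite (bigD1 j) //= aj mul0r /marginal big1 // => b /forall_inP /(_ _ jF) /eqP bj.
  apply/eqP; apply: contraFT aj => Qb; apply/eqP; rewrite -bj.
  by apply: det Qb; move: jF; rewrite inE => /andP[_ /eqP].
- have jF : val j \in measured_friends IF x by rewrite inE (valP j) xj eqxx.
  have /lt0r_neq0 : 0 < marginal Q (measured_friends IF x) a.
    by apply: lt_le_trans (marginal_ge _ a bQ); rewrite lt0r Qa (bQ x).1.
  rewrite det (bigD1 j) //= mulf_eq0 negb_or => /andP[+ _].
  by rewrite pnatr_eq0 eqb0 negbK => /eqP.
Qed.

Definition mixture (T : finType) (p : T -> R) (Q : T -> cond_family R S) :
    cond_family R S :=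
  fun x a => \sum_t p t * Q t x a.

Section Mixture.
Variables (T : finType) (p : T -> R) (Q : T -> cond_family R S).
Hypothesis p_distr : is_distribution p.

Lemma mixture_behaviour : (forall t, is_behaviour (Q t)) ->
  is_behaviour (mixture p Q).
Proof.
move=> bQ x; split=> [a|].
  by apply: sumr_ge0 => t _; rewrite mulr_ge0 ?p_distr.1 ?(bQ t x).1.
rewrite exchange_big -[RHS]p_distr.2; apply: eq_bigr => t _.
by rewrite -mulr_sumr (bQ t x).2 mulr1.
Qed.

Lemma marginal_mixture V (x : settings S) (a : outcomes x) :
  marginal (mixture p Q) V a = \sum_t p t * marginal (Q t) V a.
Proof.
by rewrite /marginal exchange_big; apply: eq_bigr => t _; rewrite mulr_sumr.
Qed.

Lemma mixture_local_agency : (forall t, local_agency (Q t)) ->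
  local_agency (mixture p Q).
Proof.
move=> aQ V x x' a a' aa'; rewrite !marginal_mixture.
by apply: eq_bigr => t _; rewrite (aQ t V x x' a a').
Qed.

Lemma mixture_support (x : settings S) (a : outcomes x) :
  mixture p Q a != 0 -> exists2 t, p t != 0 & Q t a != 0.
Proof.
move=> w0; apply: contrapT => no; move/eqP: w0; apply; apply: big1 => t _.
apply/eqP; rewrite mulf_eq0; apply: contraT; rewrite negb_or => /andP[pt Qt].
by exfalso; apply: no; exists t.
Qed.

End Mixture.

Definition indicator (h : forall x : settings S, outcomes x) : cond_family R S :=
  fun x a => (a == h x)%:R.

Lemma indicator_behaviour h : is_behaviour (indicator h).
Proof.
move=> x; split=> [a|]; first by rewrite ler0n.
by rewrite (bigD1 (h x)) //= /indicator eqxx big1 ?addr0 // => b /negbTE ->.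
Qed.

Lemma marginal_indicator h V (x : settings S) (a : outcomes x) :
  marginal (indicator h) V a = [forall i in V, h x i == a i]%:R.
Proof.
rewrite /marginal big_mkcond (bigD1 (h x)) //= /indicator eqxx big1 ?addr0.
  by case: ifP.
by move=> b /negbTE ->; case: ifP.
Qed.

(** Deterministic local assignments; the families [indicator (play g)] are the vertices of the local
    polytope. *)
Definition strategy :=
  {dffun forall q : {i : party S & setting i}, outcome (tagged q)}.

Definition play (g : strategy) (x : settings S) : outcomes x :=
  [ffun i => g (Tagged (fun i => setting i) (x i))].

Lemma play_local_agency g : local_agency (indicator (play g)).
Proof.
move=> V x x' a a' aa'; rewrite !marginal_indicator; congr (nat_of_bool _)%:R.
apply: eq_forallb_in => i iV; rewrite !ffunE.
have := aa' i iV; rewrite /tag_outcome; move: (a i) (a' i).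
(* Identifies the two settings, so that both outcomes get the same type. *)
case: _ / (congr1 tag (aa' i iV) : x i = x' i) => u v.
by move/tag_outcome_inj ->.
Qed.

Lemma play_tag g (x : settings S) i (s : setting i) : x i = s ->
  tag_outcome (play g x i) = tag_outcome (g (Tagged (fun i => setting i) s)).
Proof. by move=> <-; rewrite ffunE. Qed.

End Mixtures.

(** Values are compared as tagged pairs because [f j = i] is only a propositional equality.
    Injectivity makes the prescriptions compatible; nonemptiness fills the other places. *)
Lemma dffun_extend (I J : finType) (T_ : I -> finType) (f : J -> I)
    (v : forall j, T_ (f j)) :
  injective f -> (forall i, (0 < #|T_ i|)%N) ->
  exists g : {dffun forall i, T_ i}, forall j, g (f j) = v j.
Proof.
move=> f_inj T0.
have H i : exists t : T_ i, forall j, f j = i ->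
    Tagged (fun i => T_ i) t = Tagged (fun i => T_ i) (v j).
  have [[j <-]|no] := pselect (exists j, f j = i).
    by exists (v j) => j' /f_inj ->.
  have /card_gt0P[t _] := T0 i.
  by exists t => j fj; case: no; exists j.
exists [ffun i => sval (cid (H i))] => j; rewrite ffunE.
case: cid => t /= /(_ j erefl) /eqP.
by rewrite eq_Tagged => /eqP.
Qed.

Lemma outcome_gt0 (S : public_scenario) (i : party S) (s : setting i) :
  (0 < #|outcome s|)%N.
Proof. exact: ltnW (outcome_gt1 s). Qed.

Lemma friend_strategy (S : public_scenario) (IF : {set party S})
    (c : friend_outcomes IF) :
  exists g : strategy S,
    forall j, g (Tagged (fun i => setting i) (setting1 (val j))) = c j.
Proof.
apply: (@dffun_extend {i : party S & setting i} _ (fun q => outcome (tagged q))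
  (fun j : {i | i \in IF} => Tagged (fun i => setting i) (setting1 (val j)))).
  by move=> j j' /(congr1 tag) /val_inj.
by move=> q; apply: outcome_gt0.
Qed.

(** * Local Friendliness models as finite mixtures *)

Section FriendMixtures.
Variables (R : realType) (S : public_scenario).

Lemma play_deterministic_on (IF : {set party S}) (c : friend_outcomes IF)
    (g : strategy S) :
  (forall j, g (Tagged (fun i => setting i) (setting1 (val j))) = c j) ->
  deterministic_on c (indicator R (play g)).
Proof.
move=> gE x a j xj; rewrite /indicator pnatr_eq0 eqb0 negbK => /eqP ->.
by rewrite (play_tag _ xj) gE.
Qed.

(** The index [t] may carry more information than the friends' outcomes: [P c] is the mixture
    conditioned on [f t = c]. *)
Lemma LF_mixture (IF : {set party S}) (T : finType) (p : T -> R)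
    (Q : T -> cond_family R S) (f : T -> friend_outcomes IF) (w : cond_family R S) :
  is_distribution p -> (forall t, is_behaviour (Q t)) ->
  (forall t, local_agency (Q t)) -> (forall t, deterministic_on (f t) (Q t)) ->
  (forall x (a : outcomes x), w x a = mixture p Q a) -> LF R IF w.
Proof.
move=> pd bQ aQ dQ wE.
have -> : w = mixture p Q.
  by apply: functional_extensionality_dep => x; apply/funext => a.
split; first exact: mixture_behaviour.
have H := @friend_strategy S IF.
pose Pc c := \sum_(t | f t == c) p t.
pose pc c t := (f t == c)%:R * p t / Pc c.
have pcd c : Pc c != 0 -> is_distribution (pc c).
  move=> Pc0; split=> [t|].
    by rewrite /pc mulr_ge0 ?invr_ge0 ?sumr_ge0 ?mulr_ge0 ?pd.1 // => t' _; rewrite pd.1.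
  rewrite -mulr_suml -[RHS](divff Pc0); congr (_ / _).
  by rewrite [RHS]big_mkcond; apply: eq_bigr => t _; case: eqP; rewrite ?mul1r ?mul0r.
(* A string [c] of probability 0 still needs a behaviour compatible with it; a deterministic
   strategy extending [c] serves. *)
exists Pc, (fun c => if Pc c == 0 then indicator R (play (sval (cid (H c))))
                     else mixture (pc c) Q).
have bP c : is_behaviour (if Pc c == 0 then indicator R (play (sval (cid (H c))))
                     else mixture (pc c) Q).
  case: ifPn => [_|/pcd]; first exact: indicator_behaviour.
  by move/mixture_behaviour; apply.
split=> //.
- split=> [c|]; first by apply: sumr_ge0 => t _; rewrite pd.1.
  by rewrite -pd.2 (partition_big f xpredT).
- move=> x a; rewrite /mixture (partition_big f xpredT) //=; apply: eq_bigr => c _.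
  case: ifPn => [/eqP Pc0|Pc0].
    rewrite Pc0 mulr0 big1 // => t /eqP ft.
    rewrite (psumr_eq0P _ Pc0) ?mul0r ?ft// => t' _; exact: pd.1.
  rewrite mulr_suml [LHS]big_mkcond; apply: eq_bigr => t _; rewrite /pc.
  by case: eqP => _; [rewrite mul1r mulrAC divfK | rewrite !mul0r].
- move=> c; case: ifPn => _; first exact: play_local_agency.
  exact: mixture_local_agency.
- move=> c; apply/deterministic_onP => //; case: ifPn => [_|Pc0].
    by apply: play_deterministic_on; case: cid.
  move=> x a j xj /mixture_support[t pt Qa].
  have fc : f t = c.
    by apply/eqP; apply: contraNT pt => /negbTE ft; rewrite /pc ft !mul0r.
  by rewrite -fc; apply: (dQ t x a j xj Qa).
Qed.

(** A model for [IF] is regrouped by the restriction of [c] to [IF']. *)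
Lemma LF_anti (IF IF' : {set party S}) : IF' \subset IF -> LF R IF `<=` LF R IF'.
Proof.
move=> /fintype.subsetP sub w [_ [Pc [P [Pcd bP wE aP dP]]]].
pose f (c : friend_outcomes IF) : friend_outcomes IF' :=
  [ffun j : {i | i \in IF'} => c (exist _ (val j) (sub _ (valP j)))].
apply: (LF_mixture (f := f) Pcd bP aP) => [c x a j xj Pa|x a]; last first.
  by rewrite wE; apply: eq_bigr => c _; rewrite mulrC.
rewrite ffunE.
by have /(deterministic_onP _ (bP c)) d := dP c; apply: (d x a (exist _ (val j) _)).
Qed.

Lemma sum_prod_dffun (I : finType) (T_ : I -> finType) (F : forall i, T_ i -> R) :
  \sum_(g : {dffun forall i, T_ i}) \prod_i F i (g i) = \prod_i \sum_t F i t.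
Proof.
rewrite (reindex (@dffun_of_fprod _ T_)); last exact/onW_bij/dffun_of_fprod_bij.
pose F' i : {ffun T_ i -> R} := [ffun t => F i t].
transitivity (\sum_(g : fprod T_) \prod_(i in I) F' i (g i)).
  by apply: eq_bigr => g _; apply: eq_bigr => i _; rewrite !ffunE.
rewrite (big_fprod _ _ F').
transitivity (\prod_i \sum_(u | tagged_with T_ i u) untag 0 (F' i) u).
  by rewrite bigA_distr_big_dep; apply: eq_bigl => g.
apply: eq_bigr => i _; transitivity (\sum_t F' i t); last first.
  by apply: eq_bigr => t _; rewrite ffunE.
rewrite (big_tag (fun i (t : T_ i) => F' i t)).
exact: eq_bigl.
Qed.

(** When outputs are drawn independently at every setting, those at settings not chosen by [x] sum
    to 1 and the chosen factors remain. *)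
Lemma sum_play (p : forall i (s : setting (S := S) i), outcome s -> R)
    (x : settings S) (a : outcomes x) :
  (forall i (s : setting i), \sum_o p i s o = 1) ->
  \sum_(g : strategy S) (\prod_q p (tag q) (tagged q) (g q)) * (a == play g x)%:R
  = \prod_i p i (x i) (a i).
Proof.
move=> p1.
(* The event [a = play g x] is split into one condition per party and setting, void unless [x]
   selects that setting; the sum over strategies then factorises. *)
pose E (q : {i : party S & setting i}) (o : outcome (tagged q)) :=
  (x (tag q) == tagged q) ==> (tag_outcome o == tag_outcome (a (tag q))).
transitivity (\sum_(g : strategy S) \prod_q (p (tag q) (tagged q) (g q) * (E q (g q))%:R)).
  apply: eq_bigr => g _; rewrite big_split /=; congr (_ * _).
  have [aE|ne] := eqVneq a (play g x).
    rewrite big1 // => -[i s] _; rewrite /E /=; case: eqP => //= xs.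
    by rewrite aE (play_tag _ xs) eqxx.
  have [i ai] : exists i, a i != play g x i.
    apply/existsP; apply: contraR ne; rewrite negb_exists => /forallP H.
    by apply/eqP/ffunP => i; apply/eqP; rewrite -[_ == _]negbK.
  rewrite (bigD1 (Tagged (fun i => setting i) (x i))) //= /E /= eqxx /=.
  case: eqP => [/tag_outcome_inj e|]; last by rewrite mul0r.
  by move: ai; rewrite ffunE e eqxx.
pose G i (s : setting (S := S) i) := \sum_o p i s o * (E (Tagged (fun i => setting i) s) o)%:R.
rewrite (@sum_prod_dffun _ (fun q : {i : party S & setting i} => outcome (tagged q))
  (fun q o => p (tag q) (tagged q) o * (E q o)%:R)).
transitivity (\prod_i \prod_(s : setting (S := S) i) G i s).
  rewrite (@sig_big_dep _ _ _ _ (fun i : party S => setting i) xpredT (fun _ => xpredT) G) /=.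
  by apply: eq_bigr => -[i s].
apply: eq_bigr => i _; rewrite (bigD1 (x i)) //= big1 ?mulr1; last first.
  move=> s sx; rewrite /G -[RHS](p1 i s); apply: eq_bigr => o _.
  by rewrite /E /= eq_sym (negbTE sx) mulr1.
rewrite /G (bigD1 (a i)) //= big1 ?addr0; last first.
  move=> o oa; rewrite /E /= eqxx /=; case: eqP => [/tag_outcome_inj e|]; last by rewrite mulr0.
  by rewrite e eqxx in oa.
by rewrite /E /= !eqxx mulr1.
Qed.

End FriendMixtures.

(** * Local hidden variable models inside Local Friendliness *)

Section LHVMixtures.
Variables (R : realType) (S : public_scenario).

(** Given [l], [F g l] is the probability of [g] when outputs are drawn independently at every
    setting. Integrating over [l] gives a finite mixture of deterministic strategies, where the
    friends' outcomes are read off [g] at the first settings. *)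
Lemma sub_LHV_LF (IF : {set party S}) : LHV R S `<=` LF R IF.
Proof.
move=> w [_ [d [L [mu [P [mP dP wE]]]]]].
pose F (g : strategy S) l := \prod_q P (tag q) (tagged q) l (g q).
have F0 g l : 0 <= F g l by apply: prodr_ge0 => q _; rewrite (dP _ _ l).1.
have mF g : measurable_fun [set: L] (F g) by apply: measurable_prod => q _.
have mFE g (c : R) : measurable_fun [set: L] (fun l => (F g l * c)%:E).
  by apply/measurable_EFinP; apply: measurable_funM.
have sumF l : \sum_g F g l = 1.
  rewrite (@sum_prod_dffun R _ (fun q : {i : party S & setting i} => outcome (tagged q))
    (fun q o => P (tag q) (tagged q) l o)).
  by rewrite big1 // => q _; rewrite (dP _ _ l).2.
have int1 : (\int[mu]_l (cst 1 l) = 1)%E.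
  by rewrite integral_cst // mul1e; exact: probability_setT.
have F1 g l : F g l <= 1.
  by rewrite -(sumF l) (bigD1 g) //= lerDl sumr_ge0.
(* The integral is finite since [F g l <= 1] on a probability space, so [fine] keeps its value. *)
pose p g : R := fine (\int[mu]_l (F g l)%:E)%E.
have pE g : (p g)%:E = (\int[mu]_l (F g l)%:E)%E.
  rewrite fineK // ge0_fin_numE; last by apply: integral_ge0 => l _; rewrite lee_fin.
  apply: (@le_lt_trans _ _ (\int[mu]_l (cst 1 l))%E).
    apply: ge0_le_integral => //= [l _||l _]; rewrite ?lee_fin //.
    exact/measurable_EFinP.
  by rewrite int1 ltry.
have sumE (c : strategy S -> R) : (forall g, 0 <= c g) ->
    (\sum_g p g * c g)%:E = (\int[mu]_l (\sum_g F g l * c g)%:E)%E.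
  move=> c0; under eq_integral do rewrite -sumEFin.
  rewrite ge0_integral_sum //; last by move=> g l _; rewrite lee_fin mulr_ge0.
  rewrite -sumEFin; apply: eq_bigr => g _.
  under eq_integral do rewrite EFinM muleC.
  rewrite ge0_integralZl //.
  - by rewrite -pE -EFinM mulrC.
  - exact/measurable_EFinP.
  - by move=> l _; rewrite lee_fin.
  - by rewrite lee_fin.
have pd : is_distribution p.
  split=> [g|]; first by rewrite -lee_fin pE; apply: integral_ge0 => l _; rewrite lee_fin.
  apply: EFin_inj; have := sumE (fun=> 1) (fun=> ler01).
  under eq_bigr do rewrite mulr1; move=> ->.
  under eq_integral do under eq_bigr do rewrite mulr1.
  under eq_integral do rewrite sumF.
  exact: int1.
pose f (g : strategy S) : friend_outcomes IF :=
  [ffun j : {i | i \in IF} => g (Tagged (fun i => setting i) (setting1 (val j)))].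
apply: (LF_mixture (f := f) (Q := fun g => indicator R (play g)) pd) => [g|g|g|x a].
- exact: indicator_behaviour.
- exact: play_local_agency.
- by apply: play_deterministic_on => j; rewrite ffunE.
- apply: EFin_inj; rewrite wE sumE; last by move=> g; rewrite /indicator ler0n.
  apply: eq_integral => l _; rewrite (sum_play (p := fun i s => P i s l)) // => i s.
  exact: (dP i s l).2.
Qed.

End LHVMixtures.

(** * Hidden variables with finitely many values *)

Section FiniteLHV.
Variables (R : realType) (N : nat) (p : nat -> {nonneg R}).
Hypothesis p1 : \sum_(k < N) (p k)%:num = 1.

Definition discrete_prob : set nat -> \bar R := msum (fun k => mscale (p k) \d_k) N.

HB.instance Definition _ := Measure.on discrete_prob.

Lemma discrete_prob_setT : discrete_prob [set: nat] = 1%E.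
Proof.
transitivity (\sum_(k < N) (p k)%:num%:E)%E; last by rewrite sumEFin p1.
by apply: eq_bigr => k _; rewrite /= /mscale /= diracT mule1.
Qed.

HB.instance Definition _ :=
  Measure_isProbability.Build _ _ R discrete_prob discrete_prob_setT.

Lemma exists_discrete_prob : exists mu : probability nat R,
  forall f : nat -> \bar R, (forall k, 0 <= f k)%E ->
  (\int[mu]_k f k = \sum_(k < N) (p k)%:num%:E * f k)%E.
Proof.
exists discrete_prob => f f0; rewrite ge0_integral_measure_sum //=.
apply: eq_bigr => i _.
by rewrite ge0_integral_mscale //= integral_dirac //= diracT mul1e.
Qed.

End FiniteLHV.

Section LHVIntro.
Variables (R : realType) (S : public_scenario).

(** The index set is numbered and carried to [nat], where every function is measurable and [p]
    becomes a sum of weighted Dirac masses. The default [t0] of [nth] occurs only for [k >= #|T|],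
    which the measure does not charge. *)
Lemma LHV_mixture (T : finType) (p : T -> R)
    (D : T -> forall (i : party S) (s : setting i), outcome s -> R) (w : cond_family R S) :
  is_behaviour w -> is_distribution p -> (forall t i s, is_distribution (D t i s)) ->
  (forall x (a : outcomes x), w x a = \sum_t p t * \prod_i D t i (x i) (a i)) ->
  LHV R S w.
Proof.
move=> bw pd dD wE.
have [t0 _] : exists t0 : T, True.
  have /card_gt0P[t _] : (0 < #|T|)%N; last by exists t.
  have [_] := pd; apply: contra_eqT; rewrite -leqNgt leqn0 => /eqP /card0_eq e.
  by rewrite big_pred0 // eq_sym oner_eq0.
pose t_ k := nth t0 (enum T) k.
pose pn k : {nonneg R} := NngNum (pd.1 (t_ k)).
have sumE (h : T -> R) : \sum_(k < #|T|) h (t_ k) = \sum_t h t.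
  by rewrite -[RHS]big_enum /= (big_nth t0) big_mkord cardE.
have pn1 : \sum_(k < #|T|) (pn k)%:num = 1 by rewrite /= sumE pd.2.
have [mu intE] := exists_discrete_prob pn1.
split=> //; exists _, nat, mu, (fun i s k => D (t_ k) i s).
split=> // x a.
rewrite intE; last first.
  by move=> k; rewrite lee_fin prodr_ge0 // => i _; rewrite (dD _ _ _).1.
rewrite wE -sumE -sumEFin.
by apply: eq_bigr => k _; rewrite EFinM.
Qed.

End LHVIntro.

(** * The Popescu-Rohrlich box *)

Section PopescuRohrlich.
Variables (R : realType) (S : public_scenario).

(** Bits are embedded as the first two entries of the enumeration of outcomes. *)
Definition bool_outcome (i : party S) (s : setting i) (b : bool) : outcome s :=
  @enum_val (outcome s) predT
    (Ordinal (leq_ltn_trans (leq_b1 b) (outcome_gt1 s))).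

(** Takes a tagged outcome, so that bits can be rewritten along equalities between outcomes under
    different settings. *)
Definition outcome_bit (i : party S) (t : {s : setting i & outcome s}) : bool :=
  tagged t == bool_outcome (tag t) true.

Lemma bool_outcomeK (i : party S) (s : setting i) b :
  outcome_bit (tag_outcome (bool_outcome s b)) = b.
Proof.
rewrite /outcome_bit /= /bool_outcome (inj_eq enum_val_inj) -val_eqE /=.
by case: b.
Qed.

Lemma eq_tag_outcome (i : party S) (s s' : setting i) (a : outcome s)
    (a' : outcome s') (F : forall s : setting i, outcome s) :
  tag_outcome a = tag_outcome a' -> (F s == a) = (F s' == a').
Proof.
move=> e; have ss' : s = s' := congr1 tag e.
by case: _ / ss' in a' e *; rewrite (tag_outcome_inj e).
Qed.

Variables (k j : party S) (v0 v1 : setting j).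
Hypotheses (kj : k != j) (v01 : v0 != v1).

(** When [j] uses [v0] or [v1], the parity of the bits of [k] and [j] is the product of the inputs
    [x k = setting1 k] and [x j = v0]. Under its other settings the output of [j] is
    predetermined. *)
Definition pr_bit (r : bool) (x : settings S) (i : party S) : bool :=
  if i == k then r else
  if i == j then
    ((x j == v0) || (x j == v1)) && (r (+) ((x k == setting1 k) && (x j == v0)))
  else false.

Definition pr_outcomes (r : bool) (x : settings S) : outcomes x :=
  [ffun i => bool_outcome (x i) (pr_bit r x i)].

Definition pr_box : cond_family R S :=
  mixture (fun _ : bool => 2^-1) (fun r => indicator R (pr_outcomes r)).

Let half_distr : is_distribution (fun _ : bool => 2^-1 : R).
Proof.
split=> [_|]; first by rewrite invr_ge0 ler0n.
by rewrite big_bool /= -[2^-1]mul1r -splitr.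
Qed.

Lemma pr_box_behaviour : is_behaviour pr_box.
Proof. by apply: mixture_behaviour => // r; exact: indicator_behaviour. Qed.

(* Restricted to [V], a change of settings outside [V] amounts to flipping the
   shared random bit. *)
Lemma pr_box_local_agency : local_agency pr_box.
Proof.
move=> V x x' a a' aa'; rewrite !marginal_mixture.
pose d := if k \in V then false else
  ((x k == setting1 k) && (x j == v0)) (+) ((x' k == setting1 k) && (x' j == v0)).
have d_inj : injective (addb d) by case: (d) => -[] [].
rewrite [RHS](reindex_inj d_inj); apply: eq_bigr => r _.
rewrite !marginal_indicator; congr (_ * (nat_of_bool _)%:R).
have xx' i : i \in V -> x i = x' i by move=> /aa' /(congr1 tag).
have bit_eq i : i \in V -> pr_bit r x i = pr_bit (d (+) r) x' i.
  move=> iV; rewrite /pr_bit /d.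
  have [ik|ik] := eqVneq i k; first by rewrite -ik iV.
  have [ij|//] := eqVneq i j; have xj : x j = x' j by apply: xx'; rewrite -ij.
  case: ifP => [kV|_]; first by rewrite (xx' _ kV) xj.
  rewrite xj; congr (_ && _).
  by case: r; case: (_ && _); case: (_ && _).
apply: eq_forallb_in => i iV; rewrite !ffunE bit_eq //.
exact: (eq_tag_outcome (fun s => bool_outcome s _) (aa' i iV)).
Qed.

Lemma pr_box_bits (x : settings S) (a : outcomes x) u v :
  x k = u -> x j = v -> pr_box a != 0 -> (v == v0) || (v == v1) ->
  outcome_bit (tag_outcome (a j)) =
  outcome_bit (tag_outcome (a k)) (+) ((u == setting1 k) && (v == v0)).
Proof.
move=> <- <- /mixture_support[r _]; rewrite /indicator pnatr_eq0 eqb0 negbK => /eqP -> xj.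
by rewrite !ffunE !bool_outcomeK /pr_bit eqxx eq_sym (negbTE kj) eqxx xj.
Qed.

(** A friend in [IF] measured under its first setting always outputs the bit [false]: it is not [k],
    and if it is [j], that setting is neither [v0] nor [v1]. So a constant [c] and a one-point
    mixture suffice. *)
Lemma pr_box_LF (IF : {set party S}) : k \notin IF ->
  (j \in IF -> v0 != setting1 j /\ v1 != setting1 j) -> LF R IF pr_box.
Proof.
move=> kIF jIF.
pose c : friend_outcomes IF :=
  [ffun i : {i | i \in IF} => bool_outcome (setting1 (val i)) false].
have ud : is_distribution (fun _ : unit => 1 : R).
  by split=> [_|]; rewrite ?ler01 // big_const card_unit /= addr0.
apply: (LF_mixture (f := fun=> c) (Q := fun=> pr_box) ud) => [_|_|_|x a].
- exact: pr_box_behaviour.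
- exact: pr_box_local_agency.
- move=> x a i xi /mixture_support[r _].
  rewrite /indicator pnatr_eq0 eqb0 negbK => /eqP ->; rewrite !ffunE xi.
  congr (tag_outcome (bool_outcome _ _)); rewrite /pr_bit.
  case: eqP => [ik|_]; first by case/negP: kIF; rewrite -ik (valP i).
  case: eqP => // ij; have [|h0 h1] := jIF; first by rewrite -ij (valP i).
  have -> : x j = setting1 j by case: _ / ij.
  by rewrite ![setting1 _ == _]eq_sym (negbTE h0) (negbTE h1).
- by rewrite /mixture big_const card_unit /= addr0 mul1r.
Qed.

(** Let [e] be the bit that [c] imposes on [k] under its first setting. The strings [a] and [a2]
    share the bit of [k] under [u1], so [j] gives the same bit under [v0] and [v1]; but [a1] makes
    it the negation of [e] and [a3] makes it [e]. *)
Lemma pr_box_notin_LF (IF : {set party S}) (u1 : setting k) :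
  u1 != setting1 k -> k \in IF -> ~ LF R IF pr_box.
Proof.
move=> u1_neq kIF [_ [Pc [P [Pcd bP wE aP dP]]]].
have [c Pc0] : exists c, Pc c != 0.
  apply/existsP; have := Pcd.2; apply: contra_eqT; rewrite negb_exists => /forallP H.
  by rewrite big1 1?eq_sym ?oner_eq0 // => c _; apply/eqP; have := H c; rewrite negbK.
(* As [Pc c] is positive, the support of [P c] lies in that of the box. *)
have supp x (a : outcomes x) : P c x a != 0 -> pr_box a != 0.
  apply: contra_neq; rewrite wE => /psumr_eq0P H.
  have /eqP : P c x a * Pc c = 0.
    by apply: H => // c' _; rewrite mulr_ge0 ?Pcd.1 ?(bP c' x).1.
  by rewrite mulf_eq0 (negbTE Pc0) orbF => /eqP.
have det x (a : outcomes x) : x k = setting1 k -> P c x a != 0 ->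
    tag_outcome (a k) = tag_outcome (c (exist _ k kIF)).
  have /(deterministic_onP _ (bP c)) d := dP c.
  exact: (d x a (exist _ k kIF)).
pose X u v : settings S := [ffun i => dfwith (dfwith (@setting1 S) k u) j v i].
have Xk u v : X u v k = u by rewrite ffunE dfwithout 1?eq_sym // dfwithin.
have Xj u v : X u v j = v by rewrite ffunE dfwithin.
have [a Pa] : exists a, P c (X u1 v0) a != 0.
  apply/existsP; have := (bP c (X u1 v0)).2; apply: contra_eqT.
  rewrite negb_exists => /forallP H.
  by rewrite big1 1?eq_sym ?oner_eq0 // => b _; apply/eqP; have := H b; rewrite negbK.
have bits u v (b : outcomes (X u v)) : P c (X u v) b != 0 -> (v == v0) || (v == v1) ->
    outcome_bit (tag_outcome (b j)) =
    outcome_bit (tag_outcome (b k)) (+) ((u == setting1 k) && (v == v0)).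
  by move=> /supp; apply: pr_box_bits.
have [a1 Pa1 a1j] : exists2 a1 : outcomes (X (setting1 k) v0),
    P c (X (setting1 k) v0) a1 != 0 & tag_outcome (a1 j) = tag_outcome (a j).
  by apply: local_agency_support Pa; rewrite ?Xj.
have [a2 Pa2 a2k] : exists2 a2 : outcomes (X u1 v1),
    P c (X u1 v1) a2 != 0 & tag_outcome (a2 k) = tag_outcome (a k).
  by apply: local_agency_support Pa; rewrite ?Xk.
have [a3 Pa3 a3j] : exists2 a3 : outcomes (X (setting1 k) v1),
    P c (X (setting1 k) v1) a3 != 0 & tag_outcome (a3 j) = tag_outcome (a2 j).
  by apply: local_agency_support Pa2; rewrite ?Xj.
have := bits _ _ _ Pa; have := bits _ _ _ Pa1; have := bits _ _ _ Pa2.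
have := bits _ _ _ Pa3.
rewrite a3j a2k a1j (det _ _ _ Pa1) ?Xk // (det _ _ _ Pa3) ?Xk //.
rewrite !eqxx orbT (negbTE u1_neq) [v1 == v0]eq_sym (negbTE v01) /= !addbF.
move=> -> // e1 // e2 // e3 //.
move: (e2 isT); rewrite (e3 isT) -(e1 isT).
by case: outcome_bit.
Qed.

End PopescuRohrlich.

(** * Marginals at strings that do not depend on the settings *)

Section TaggedMarginals.
Variables (R : realType) (S : public_scenario).

(** Such a string carries its own settings, so it can be compared with outcomes under different
    [x]. *)
Definition tagged_outcomes := forall i : party S, {s : setting i & outcome s}.

Definition tags (x : settings S) (a : outcomes x) : tagged_outcomes :=
  fun i => tag_outcome (a i).

Definition tagged_marginal (Q : cond_family R S) (x : settings S)
    (V : {set party S}) (T : tagged_outcomes) : R :=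
  \sum_(b : outcomes x | [forall i in V, tags b i == T i]) Q x b.

Lemma tags_inj (x : settings S) : injective (@tags x).
Proof. by move=> a b ab; apply/ffunP => i; apply/tag_outcome_inj/(congr1 (@^~ i) ab). Qed.

Lemma outcomes_of_tags (x : settings S) (V : {set party S}) (T : tagged_outcomes) :
  (forall i, i \in V -> tag (T i) = x i) ->
  exists a : outcomes x, forall i, i \in V -> tags a i = T i.
Proof.
move=> TV.
have H i : exists o : outcome (x i), i \in V -> tag_outcome o = T i.
  have [iV|] := boolP (i \in V); last by exists (bool_outcome (x i) false).
  by have := TV i iV; case: (T i) => s o /= <-; exists o.
exists [ffun i => sval (cid (H i))] => i iV.
by rewrite /tags ffunE; case: cid => o /= ->.
Qed.

Lemma marginal_tags (Q : cond_family R S) (x : settings S) (V : {set party S})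
    (a : outcomes x) : marginal Q V a = tagged_marginal Q x V (tags a).
Proof.
apply: eq_bigl => b; apply: eq_forallb_in => i _.
by rewrite /tags (inj_eq (@tag_outcome_inj _ _ _)).
Qed.

Lemma eq_tagged_marginal (Q : cond_family R S) (x : settings S) (V : {set party S})
    (T T' : tagged_outcomes) : (forall i, i \in V -> T i = T' i) ->
  tagged_marginal Q x V T = tagged_marginal Q x V T'.
Proof.
by move=> TT'; apply: eq_bigl => b; apply: eq_forallb_in => i iV; rewrite TT'.
Qed.

(** If the settings carried by [T] agree with [x] on [V], then on [V] it comes from outcomes under
    [x] and under [x'], and agency applies; otherwise both sums are empty. *)
Lemma tagged_marginal_agency (Q : cond_family R S) (x x' : settings S)
    (V : {set party S}) (T : tagged_outcomes) :
  local_agency Q -> (forall i, i \in V -> x i = x' i) ->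
  tagged_marginal Q x V T = tagged_marginal Q x' V T.
Proof.
move=> aQ xx'; have [TV|TV] := pselect (forall i, i \in V -> tag (T i) = x i); last first.
  by rewrite /tagged_marginal !big_pred0 // => b; apply/negbTE; apply/negP => /forall_inP H;
    apply: TV => i iV; have /eqP <- := H i iV; rewrite /= ?xx'.
have [a aT] := outcomes_of_tags TV.
have [|a' aT'] := @outcomes_of_tags x' V T; first by move=> i iV; rewrite TV ?xx'.
rewrite -(eq_tagged_marginal _ _ aT) -(eq_tagged_marginal _ _ aT') -!marginal_tags.
by apply: aQ => i iV; rewrite [LHS]aT // -[LHS]aT'.
Qed.

Lemma tagged_marginal_ge (Q : cond_family R S) (x : settings S) (V : {set party S})
    (a : outcomes x) : is_behaviour Q -> Q x a <= tagged_marginal Q x V (tags a).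
Proof. by move=> bQ; rewrite -marginal_tags marginal_ge. Qed.

Lemma tagged_marginal_ge0 (Q : cond_family R S) (x : settings S) (V : {set party S})
    (T : tagged_outcomes) : is_behaviour Q -> 0 <= tagged_marginal Q x V T.
Proof. by move=> bQ; apply: sumr_ge0 => b _; apply: (bQ x).1. Qed.

Lemma sum_tag_outcome (i : party S) (s : setting i) (t : {s : setting i & outcome s}) :
  tag t = s -> is_distribution (fun o : outcome s => (tag_outcome o == t)%:R : R).
Proof.
case: t => s' o /= <-; split=> [u|]; first by rewrite ler0n.
rewrite (bigD1 o) //= eqxx big1 ?addr0 // => o' oo'.
by rewrite (inj_eq (@tag_outcome_inj _ _ _)) (negbTE oo').
Qed.

Lemma forall_in_dfwith (k : party S) (T T' : tagged_outcomes)
    (t : {s : setting k & outcome s}) :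
  [forall i in [set: party S]%SET, T i == dfwith T' k t i] =
  [forall i in [set~ k]%SET, T i == T' i] && (T k == t).
Proof.
apply/forall_inP/andP => [H|[/forall_inP H /eqP Tk] i _].
  split; last by have := H k (finset.in_setT k); rewrite dfwithin.
  apply/forall_inP => i; rewrite !inE => ik; have := H i (finset.in_setT i).
  by rewrite dfwithout 1?eq_sym.
by case: dfwithP => [|i' ki']; [rewrite Tk | apply: H; rewrite !inE eq_sym].
Qed.

Lemma sum_tagged_marginal (Q : cond_family R S) (x : settings S) (k : party S)
    (s : setting k) (T : tagged_outcomes) : x k = s ->
  \sum_(o : outcome s) tagged_marginal Q x [set: party S]%SET (dfwith T k (tag_outcome o)) =
  tagged_marginal Q x [set~ k]%SET T.
Proof.
move=> xs; rewrite /tagged_marginal [RHS]big_mkcond.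
transitivity (\sum_(o : outcome s) \sum_(b : outcomes x)
    (if [forall i in [set~ k]%SET, tags b i == T i] && (tags b k == tag_outcome o)
     then Q x b else 0)).
  apply: eq_bigr => o _; rewrite big_mkcond; apply: eq_bigr => b _.
  by rewrite forall_in_dfwith.
rewrite exchange_big; apply: eq_bigr => b _.
case: ifP => _ /=; last by rewrite big1.
rewrite -[RHS]mulr1 -(sum_tag_outcome (t := tags b k) xs).2 mulr_sumr.
by apply: eq_bigr => o _; rewrite eq_sym; case: eqP; rewrite ?mulr1 ?mulr0.
Qed.

End TaggedMarginals.

Lemma prod_natb (R : realType) (I : finType) (A B : pred I) :
  \prod_(i | A i) (B i)%:R = [forall (i | A i), B i]%:R :> R.
Proof.
have [/forall_inP H|] := boolP [forall (i | A i), B i].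
  by rewrite big1 // => i /H ->.
rewrite negb_forall_in => /exists_inP[i Ai /negbTE Bi].
by rewrite (bigD1 i) //= Bi mul0r.
Qed.

(** * A local model when the first outputs of all parties but one are known *)

Section SingleEffectiveParty.
Variables (R : realType) (S : public_scenario) (k : party S).
Hypothesis two_settings : forall i : party S, i != k -> (nsettings i <= 2)%N.

Definition setting2 (i : party S) : setting i := Ordinal (nsettings_gt1 i).

(** The settings whose outputs off [k] serve as hidden variable. *)
Definition settings2 (s : setting k) : settings S :=
  [ffun i => dfwith setting2 k s i].

Lemma settings2_in s : settings2 s k = s.
Proof. by rewrite ffunE dfwithin. Qed.

Lemma settings2_out s i : i != k -> settings2 s i = setting2 i.
Proof. by move=> ik; rewrite ffunE dfwithout 1?eq_sym. Qed.

Lemma setting2P (i : party S) (s : setting i) :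
  i != k -> s != setting1 i -> s = setting2 i.
Proof.
move=> /two_settings n2; rewrite -val_eqE /= => s0; apply: val_inj => /=.
by have := leq_trans (ltn_ord s) n2; case: (nat_of_ord s) s0 => [|[|[]]].
Qed.

Variable Q : cond_family R S.
Hypotheses (bQ : is_behaviour Q) (aQ : local_agency Q).

(* The probability that [k] outputs [o] under [s], conditional on the outcomes
   [b] of the other parties under their second settings; any distribution does
   when these have probability 0. *)
Definition conditional (b : tagged_outcomes S) (s : setting k) (o : outcome s) : R :=
  let m := tagged_marginal Q (settings2 (setting1 k)) [set~ k]%SET b in
  if m == 0 then (o == bool_outcome s false)%:R else
  tagged_marginal Q (settings2 s) [set: party S]%SET (dfwith b k (tag_outcome o)) / m.

(** No signalling from [k] to the others: the denominator in [conditional], taken at the first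
    setting of [k], is right for every [s]. *)
Lemma settings2_agency (s s' : setting k) (b : tagged_outcomes S) :
  tagged_marginal Q (settings2 s) [set~ k]%SET b =
  tagged_marginal Q (settings2 s') [set~ k]%SET b.
Proof.
apply: tagged_marginal_agency => // i; rewrite !inE => ik.
by rewrite !settings2_out.
Qed.

Lemma conditional_distr b s : is_distribution (@conditional b s).
Proof.
rewrite /conditional; case: eqP => [_|/eqP m0]; split=> [u|].
- by rewrite ler0n.
- rewrite (bigD1 (bool_outcome s false)) //= eqxx big1 ?addr0 // => u.
  by move=> /negbTE ->.
- by rewrite divr_ge0 // tagged_marginal_ge0.
- rewrite -mulr_suml sum_tagged_marginal ?settings2_in //.
  by rewrite (settings2_agency _ (setting1 k)) divff.
Qed.

Variable g : strategy S.
Let known (i : party S) (s : setting i) := tag_outcome (g (Tagged (fun i => setting i) s)).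
Hypothesis known_outcome : forall x (a : outcomes x) i, i != k -> x i = setting1 i ->
  Q a != 0 -> tags a i = known (setting1 i).

Definition response (b : tagged_outcomes S) :
    forall (i : party S) (s : setting i), outcome s -> R :=
  dfwith (fun i s o => (tag_outcome o == if s == setting1 i then known s else b i)%:R)
    k (@conditional b).

(** A party other than [k] has at most two settings, so one that is not the first is the second,
    under which [b] was recorded; the tags then match. *)
Lemma response_distr (s0 : setting k) (b : outcomes (settings2 s0)) i (s : setting i) :
  is_distribution (@response (tags b) i s).
Proof.
rewrite /response; have [ik|ik] := eqVneq k i.
  by case: _ / ik s => s; rewrite dfwithin; exact: conditional_distr.
rewrite dfwithout //; apply: sum_tag_outcome; case: ifP => //= /negbT s1.
by rewrite settings2_out 1?eq_sym // (setting2P _ s1) // eq_sym.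
Qed.

(** Summing out [b] with the conditional distribution of [k] rebuilds the marginal of [Q] under [y]
    on [k] and the parties using their second setting. There [x] and [y] agree, so agency moves it
    to [x], where all remaining outputs are known. *)
Lemma response_model (x : settings S) (a : outcomes x) :
  Q a = \sum_(b : outcomes (settings2 (setting1 k)))
    Q b * \prod_i @response (tags b) i (x i) (a i).
Proof.
pose y0 := settings2 (setting1 k); pose y := settings2 (x k).
pose t b i := if x i == setting1 i then known (x i) else tags b i.
have prodE (b : outcomes y0) : \prod_i @response (tags b) i (x i) (a i) =
    conditional (tags b) (a k) * [forall (i | i != k), tags a i == t y0 b i]%:R.
  rewrite (bigD1 k) //= /response dfwithin -prod_natb; congr (_ * _).
  by apply: eq_bigr => i ik; rewrite dfwithout 1?eq_sym.
under eq_bigr do rewrite prodE.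
(* If [a] contradicts a known output, both sides vanish. *)
have [/existsP[i /and3P[ik /eqP xi ai]]|] := boolP [exists i : party S,
    [&& i != k, x i == setting1 i & tags a i != known (setting1 i)]].
  have -> : Q a = 0.
    by apply/eqP; apply: contraNT ai => Qa; apply/eqP/known_outcome.
  rewrite big1 // => b _; rewrite (_ : [forall (_ | _), _] = false) ?mulr0 //.
  apply/negbTE; rewrite negb_forall_in; apply/exists_inP; exists i => //.
  by rewrite /t xi eqxx.
rewrite negb_exists => /forallP good.
have goodE i : i != k -> x i = setting1 i -> tags a i = known (setting1 i).
  by move=> ik xi; have := good i; rewrite ik xi eqxx /= negbK => /eqP.
pose J := [set i : party S | (i != k) && (x i != setting1 i)]%SET.
pose onJ z (b : outcomes z) := [forall i in J, tags b i == tags a i].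
have JE (b : outcomes y0) : [forall (i | i != k), tags a i == t y0 b i] = onJ y0 b.
  apply/forall_inP/forall_inP => H i.
    by rewrite inE => /andP[ik xi]; have := H i ik; rewrite /t (negbTE xi) eq_sym.
  move=> ik; rewrite /t; case: (x i =P setting1 i) => [xi|/eqP xi]; first by rewrite goodE // xi.
  by rewrite eq_sym H // inE ik.
pose m z (b : outcomes z) := tagged_marginal Q y0 [set~ k]%SET (tags b).
pose off (b : outcomes y0) (b' : outcomes y) :=
  [forall i in [set~ k]%SET, tags b' i == tags b i].
(* Covers division by zero: [Q] vanishes wherever [m] does. *)
have Q0 z s (b : outcomes z) : z = settings2 s -> m z b = 0 -> Q b = 0.
  move=> zs mb; apply/eqP; rewrite eq_le (bQ z).1 andbT -mb /m.
  by rewrite (settings2_agency _ s) -zs tagged_marginal_ge.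
(* The conditional probability is expanded over the strings [b'] under [y] that match [b] off
   [k]. *)
have termE (b : outcomes y0) :
    Q b * (conditional (tags b) (a k) * [forall (i | i != k), tags a i == t y0 b i]%:R)
    = \sum_(b' : outcomes y) (if off b b' && (tags b' k == tags a k) && onJ y0 b
                              then Q b * Q b' / m y0 b else 0).
  rewrite JE; have [mb|mb] := eqVneq (m y0 b) 0.
    rewrite (Q0 _ _ b erefl mb) mul0r big1 // => b' _.
    by rewrite !mul0r if_same.
  rewrite /conditional -/(m y0 b) (negbTE mb) /tagged_marginal big_mkcond /=.
  rewrite !mulr_suml mulr_sumr; apply: eq_bigr => b' _.
  rewrite forall_in_dfwith -/(off b b'); case: (off b b' && _) => /=; last first.
    by rewrite !mul0r mulr0.
  by case: (onJ y0 b); rewrite ?mulr1 ?mulr0 // mulrA.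
rewrite (eq_bigr _ (fun b _ => termE b)) exchange_big /=.
(* For fixed [b'], the weights [Q b] of the matching [b] sum to [m y b'], which cancels the
   denominator. *)
have innerE (b' : outcomes y) :
    \sum_(b : outcomes y0) (if off b b' && (tags b' k == tags a k) && onJ y0 b
                            then Q b * Q b' / m y0 b else 0)
    = if (tags b' k == tags a k) && onJ y b' then Q b' else 0.
  have offE b : off b b' -> onJ y0 b = onJ y b' /\ m y0 b = m y b'.
    move=> /forall_inP bb'; have {}bb' i : i != k -> tags b i = tags b' i.
      by move=> ik; apply/esym/eqP/bb'; rewrite !inE.
    split; first by apply: eq_forallb_in => i; rewrite inE => /andP[ik _]; rewrite bb'.
    by apply: eq_tagged_marginal => i; rewrite !inE; apply: bb'.
  transitivity (\sum_(b : outcomes y0 | off b b')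
     (if (tags b' k == tags a k) && onJ y b' then Q b' / m y b' else 0) * Q b).
    rewrite [RHS]big_mkcond; apply: eq_bigr => b _.
    have [/offE[-> ->] /=|//] := boolP (off b b').
    by case: ifP => _; rewrite ?mul0r // -mulrA mulrC.
  rewrite -mulr_sumr (_ : \sum_(b | _) _ = m y b'); last first.
    by apply: eq_bigl => b; apply: eq_forallb_in => i _; rewrite eq_sym.
  case: ifP => _; rewrite ?mul0r //.
  have [mb|mb] := eqVneq (m y b') 0; last by rewrite divfK.
  by rewrite mb mulr0 (Q0 _ _ b' erefl mb).
rewrite (eq_bigr _ (fun b' _ => innerE b')) -big_mkcond /=.
transitivity (tagged_marginal Q y (k |: J)%SET (tags a)); last first.
  apply: eq_bigl => b; apply/forall_inP/andP => [H|[Hk /forall_inP HJ] i].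
    split; first by apply: H; rewrite !inE eqxx.
    by apply/forall_inP => i iJ; apply: H; rewrite finset.in_setU iJ orbT.
  by rewrite finset.in_setU1 => /orP[/eqP ->|/HJ].
have yx i : i \in (k |: J)%SET -> y i = x i.
  rewrite finset.in_setU1 inE => /orP[/eqP ->|/andP[ik xi]]; first exact: settings2_in.
  by rewrite /y settings2_out // (setting2P ik xi).
rewrite (tagged_marginal_agency _ aQ yx) /tagged_marginal (bigD1 a) /=; last first.
  exact/forall_inP.
(* Outside [k |: J] the outputs under [x] are known, so no string other than [a] contributes to the
   marginal. *)
rewrite big1 ?addr0 // => b /andP[/forall_inP bW]; apply: contraNeq => Qb.
apply/eqP/tags_inj/functional_extensionality_dep => i.
have [iW|] := boolP (i \in (k |: J)%SET); first exact/eqP/bW.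
rewrite finset.in_setU1 inE negb_or negb_and => /andP[ik].
rewrite ik negbK /= => /eqP xi.
by rewrite (known_outcome ik xi Qb) goodE.
Qed.

End SingleEffectiveParty.

(** The hidden variable is the pair of [c] and the outputs [b] under [y0]. The strategy [G c] is
    consulted only at first settings of parties other than [k]; all of them are in [IF], so these
    outputs come from [c]. *)
Lemma LF_sub_LHV (R : realType) (S : public_scenario) (IF : {set party S})
    (k : party S) :
  (forall i, i != k -> i \in IF /\ (nsettings i <= 2)%N) -> LF R IF `<=` LHV R S.
Proof.
move=> H w [bw [Pc [P [Pcd bP wE aP dP]]]].
have two i : i != k -> (nsettings i <= 2)%N by move/H => -[].
have [G GE] : exists G : friend_outcomes IF -> strategy S, forall c j,
    G c (Tagged (fun i => setting i) (setting1 (val j))) = c j.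
  by exists (fun c => sval (cid (friend_strategy c))) => c; case: cid.
have known c x (a : outcomes x) i : i != k -> x i = setting1 i -> P c x a != 0 ->
    tags a i = tag_outcome (G c (Tagged (fun i => setting i) (setting1 i))).
  move=> /H[iIF _] xi Pa; have /(deterministic_onP _ (bP c)) d := dP c.
  by rewrite [LHS](d x a (exist _ i iIF) xi Pa) -(GE c (exist _ i iIF)).
pose y0 := settings2 (setting1 k).
pose p (l : friend_outcomes IF * outcomes y0) := Pc l.1 * P l.1 y0 l.2.
apply: (@LHV_mixture R S _ p (fun l => response k (P l.1) (G l.1) (tags l.2))) => //.
- split=> [l|]; first by rewrite mulr_ge0 ?Pcd.1 ?(bP _ _).1.
  rewrite -(pair_bigA _ (fun c b => Pc c * P c y0 b)) /= -[RHS]Pcd.2.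
  by apply: eq_bigr => c _; rewrite -mulr_sumr (bP c y0).2 mulr1.
- by move=> l i s; apply: response_distr.
- move=> x a; rewrite wE.
  rewrite -(pair_bigA _ (fun c b => Pc c * P c y0 b *
    \prod_i response k (P c) (G c) (tags b) (a i))) /=.
  apply: eq_bigr => c _; rewrite (response_model two (bP c) (aP c) (known c)).
  by rewrite mulrC mulr_sumr; apply: eq_bigr => b _; rewrite mulrA.
Qed.

(** * The dichotomy *)

Theorem theorem19 (R : realType) (Sp : public_scenario)
    (IF IF' : {set party Sp}) (IF'_neq0 : IF' != finset.set0)
    (IF'_proper : IF' \proper IF) :
  (LF R IF = LF R IF' /\ LF R IF' = LHV R Sp) \/
  LF R IF `<` LF R IF'.
Proof.
have [sub [k kIF kIF']] := fintype.properP IF'_proper.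
have [[j [jk jP]]|no] := pselect (exists j, j != k /\ ((j \notin IF') || (2 < nsettings j)%N)).
  right; split; first exact: LF_anti.
  have u1k : setting2 k != setting1 k by rewrite -val_eqE.
  (* Without a friend in [IF'], [j] uses its first two settings; with one, it has a third setting
     and uses the second and third. *)
  have [v0 [v1 [v01 jv]]] : exists v0 v1 : setting j, v0 != v1 /\
      (j \in IF' -> v0 != setting1 j /\ v1 != setting1 j).
    have [jIF'|_] := boolP (j \in IF'); last first.
      by exists (setting1 j), (setting2 j); rewrite -val_eqE.
    rewrite jIF' /= in jP.
    by exists (setting2 j), (Ordinal jP); rewrite -!val_eqE.
  have kj : k != j by rewrite eq_sym.
  move=> /(_ _ (pr_box_LF R kIF' jv)).
  exact: (pr_box_notin_LF kj v01 u1k kIF).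
have LF'_LHV : LF R IF' `<=` LHV R Sp.
  apply: (LF_sub_LHV (k := k)) => i ik; split.
    by apply: contrapT => /negP iIF'; apply: no; exists i; rewrite ik iIF'.
  by rewrite leqNgt; apply/negP => i2; apply: no; exists i; rewrite ik i2 orbT.
left; split; apply/seteqP; split.
- exact: LF_anti.
- by move=> w /LF'_LHV; apply: sub_LHV_LF.
- exact: LF'_LHV.
- exact: sub_LHV_LF.
Qed.
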